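(* Let $(\{(X^\sigma, d^\sigma)\}_{\sigma \in \Sigma}, \{\alpha^{\sigma}_{\tau} \colon X^\tau\to X^\sigma\}_{\sigma \leqslant \tau})$ be an inverse system, indexed by an upward directed set $\Sigma$, in the category $\mathsf{cmn}$ of compact metric spaces and non-expansive mappings, and assume that $\alpha^\sigma_\tau$ is surjective for all $\sigma \leqslant \tau$. Then the following conditions are equivalent: (1) this system has an inverse limit in $\mathsf{cmn}$; (2) $\{X^\sigma\}_{\sigma \in \Sigma}$ is upper bounded with respect to $\preccurlyeq$; (3) $\{X^\sigma\}_{\sigma \in \Sigma}$ is upper bounded with respect to $\preccurlyeq_s$; (4) $\{X^\sigma\}_{\sigma \in \Sigma}$ is upper bounded with respect to $\preccurlyeq_i$; (5) there exists $Y \in \mathfrak{GH}$ such that $X^\sigma \preccurlyeq Y$, $X^\sigma \preccurlyeq_s Y$ and $X^\sigma \preccurlyeq_i Y$ for every $\sigma \in \Sigma$; (6) $\{X^\sigma\}_{\sigma \in \Sigma}$ is uniformly compact. Furthermore, if the inverse limit exists, its object does not depend, up to isometry, on the choice of surjective arrows for the system: if $(\{(X^\sigma, d^\sigma)\}_{\sigma \in \Sigma}, \{\beta^{\sigma}_{\tau}\}_{\sigma \leqslant \tau})$ is another inverse system in $\mathsf{cmn}$ over the same $\Sigma$ with the same objects and with all arrows surjective, then the objects of the inverse limits of the two systems are isometric.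
   Context: A mapping $f\colon (X,d)\to(Y,\varrho)$ is non-expansive if $\varrho(f(x),f(y))\leqslant d(x,y)$ for all $x,y\in X$. $\mathsf{cmn}$ is the category of all compact metric spaces with non-expansive mappings as arrows. $\mathfrak{GH}$ is the space of all compact metric spaces up to isometry. An inverse system in a category $\mathsf A$ indexed by an upward directed set $\Sigma$ is a family of objects $\{A^\sigma\}_{\sigma\in\Sigma}$ with morphisms $\{\alpha_\tau^\sigma\colon A^\tau\to A^\sigma\}_{\sigma\leqslant\tau}$ such that $\alpha_\sigma^\sigma=\mathrm{id}_{A^\sigma}$ and $\alpha_\varrho^\sigma\circ\alpha_\tau^\varrho=\alpha_\tau^\sigma$ for $\sigma\leqslant\varrho\leqslant\tau$. Its inverse limit is an object $A$ of $\mathsf A$ with morphisms $\{\alpha^\sigma\colon A\to A^\sigma\}_{\sigma\in\Sigma}$ such that $\alpha_\tau^\sigma\circ\alpha^\tau=\alpha^\sigma$ for $\sigma\leqslant\tau$, and such that for every object $A'$ and morphisms $\{\xi^\sigma\colon A'\to A^\sigma\}_{\sigma\in\Sigma}$ with $\alpha_\tau^\sigma\circ\xi^\tau=\xi^\sigma$ for $\sigma\leqslant\tau$ there is a unique morphism $\nu\colon A'\to A$ with $\alpha^\sigma\circ\nu=\xi^\sigma$ for all $\sigma\in\Sigma$. Partial orders on $\mathfrak{GH}$: $X\preccurlyeq Y$ iff there is a non-expansive mapping $\varphi\colon Y\to X$ with $\varphi(Y)=X$; $X\preccurlyeq_s Y$ iff $X\preccurlyeq K$ for some closed subset $K$ of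 $Y$; $X\preccurlyeq_i Y$ iff $X$ is isometric to a subset of $Y$. A family is upper bounded with respect to such an order if some single compact metric space lies above all its members. A family $\mathfrak K\subset\mathfrak{GH}$ is uniformly compact if it is uniformly bounded (the diameters of its members have a common finite upper bound) and for every $\varepsilon>0$ there is $N\in\mathbb N$ such that every member of $\mathfrak K$ contains an $\varepsilon$-dense set with at most $N$ elements; here $A\subset X$ is $\varepsilon$-dense if every $x\in X$ admits $a\in A$ with $d(x,a)<\varepsilon$. *)

(* Defs.v *)
From HB Require Import structures.
From mathcomp Require Import all_boot all_order all_algebra.
From mathcomp Require Import all_classical all_reals all_analysis.

Set Implicit Arguments.
Unset Strict Implicit.
Unset Printing Implicit Defensive.

Import Order.TTheory GRing.Theory Num.Theory.

Local Open Scope classical_set_scope.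
Local Open Scope ring_scope.

(* The library equips [set_type A] with the pseudometric induced from the
   ambient space; here it is completed to the induced metric. *)
Section SubspaceMetric.
Context {R : realType} {T : metricType R} (A : set T).

Let sdist (x y : A) : R := mdist (val x) (val y).

Let sdist_ge0 x y : 0 <= sdist x y.
Proof. exact: mdist_ge0. Qed.

Let sdist_positivity x y : sdist x y = 0 -> x = y.
Proof. by move=> /mdist_positivity /val_inj. Qed.

Let ballEsdist (x : A) d : ball x d = [set y | sdist x y < d].
Proof. by rewrite -initial_ballE ballEmdist. Qed.

HB.instance Definition _ := @PseudoMetric_isMetric.Build R (set_type A)
  sdist sdist_ge0 sdist_positivity ballEsdist.
End SubspaceMetric.

(* The empty space is allowed. *)
Record cmSpace (R : realType) := CMSpace {
  cm_sort :> metricType R;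
  cm_compact : compact [set: cm_sort]
}.

Section Maps.
Context {R : realType}.
Implicit Types X Y : metricType R.

Definition nonexpansive X Y (f : X -> Y) :=
  forall x y, mdist (f x) (f y) <= mdist x y.

Definition surjective X Y (f : X -> Y) := range f = [set: Y].

Definition isometric X Y :=
  exists f : X -> Y, bijective f /\ forall x y, mdist (f x) (f y) = mdist x y.

Definition le_ne X Y := exists phi : Y -> X, nonexpansive phi /\ surjective phi.

Definition le_s X Y := exists K : set Y, closed K /\ le_ne X (set_type K).

Definition le_i X Y := exists A : set Y, isometric X (set_type A).

(* Equal to -oo for the empty space. *)
Definition diameter X : \bar R :=
  ereal_sup [set (mdist p.1 p.2)%:E | p in [set: X * X]].

Definition eps_dense X (e : R) (A : set X) :=
  forall x, exists2 a, A a & mdist x a < e.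

End Maps.

Section Families.
Context {R : realType} {I : Type}.
Implicit Types X : I -> cmSpace R.

Definition upper_bounded (le : metricType R -> metricType R -> Prop) X :=
  exists Y : cmSpace R, forall s, le (X s) Y.

Definition uniformly_bounded X :=
  exists D : R, forall s, (diameter (X s) <= D%:E)%E.

Definition uniformly_compact X :=
  uniformly_bounded X /\
  forall e : R, 0 < e -> exists N : nat, forall s,
    exists A : set (X s), (A #<= `I_N)%card /\ eps_dense e A.

End Families.

Definition upward_directed (disp : Order.disp_t) (I : preorderType disp) :=
  forall s t : I, exists u : I, (s <= u)%O /\ (t <= u)%O.

Section InverseSystems.
Context {R : realType} {disp : Order.disp_t} {I : preorderType disp}.
Implicit Types X : I -> cmSpace R.

(* [conn st] is the arrow from [X t] to [X s] attached to [st : s <= t]. *)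
Record inverse_system X := InverseSystem {
  conn : forall s t : I, (s <= t)%O -> X t -> X s;
  conn_nonexpansive : forall s t (st : (s <= t)%O), nonexpansive (conn st);
  conn_id : forall s (ss : (s <= s)%O), conn ss = id;
  conn_comp : forall s r t (sr : (s <= r)%O) (rt : (r <= t)%O) (st : (s <= t)%O),
    conn sr \o conn rt = conn st
}.

Definition surjective_system X (S : inverse_system X) :=
  forall s t (st : (s <= t)%O), surjective (conn S st).

Definition is_cone X (S : inverse_system X) (A : cmSpace R)
    (p : forall s, A -> X s) :=
  (forall s, nonexpansive (p s)) /\
  forall s t (st : (s <= t)%O), conn S st \o p t = p s.

Definition is_inverse_limit X (S : inverse_system X) (A : cmSpace R)
    (p : forall s, A -> X s) :=
  is_cone S p /\
  forall (A' : cmSpace R) (xi : forall s, A' -> X s), is_cone S xi ->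
    exists! nu : A' -> A, nonexpansive nu /\ forall s, p s \o nu = xi s.

Definition has_inverse_limit X (S : inverse_system X) :=
  exists (A : cmSpace R) (p : forall s, A -> X s), is_inverse_limit S p.

End InverseSystems.

(* Main.v *)
Require Import Defs.
From HB Require Import structures.
From mathcomp Require Import all_boot all_order all_algebra.
From mathcomp Require Import all_classical all_reals all_analysis.
From mathcomp Require Import finmap lra.

(** Everything rests on ultralimits. Fix an ultrafilter on the index set that
contains every tail; directedness provides one. Any choice of points
[z t : X t], compatible or not, then has an ultralimit: its coordinate at [s]
is the limit of the images of [z t] in the compact space [X s], and since the
connecting maps are continuous these coordinates form a thread
([ultrathread]). Threads are fixed by this operation and distances do not
grow under it. Three facts follow.

- Let the family be uniformly compact, with [e]-nets of at most [N] points.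
  The ultralimit of the [i]-th net points is a thread, and the [N] threads so
  obtained form an [e]-net, up to closing the inequality, in the space of all
  threads with the supremum metric. That space is therefore compact and it is
  the inverse limit ([uniformly_compact_has_limit]).
- When the connecting maps are surjective, a point of [X s] lifts to each
  later space, and the ultralimit of the lifts is a thread through it. The
  points of an inverse limit are exactly the threads (map a one-point space
  into it), so the projections of the limit are onto and the limit is an upper
  bound of the family ([limit_proj_surjective]).
- The limit is a least upper bound for [le_ne] ([limit_least]): if [Y] maps
  onto each [X s] by [phi s], the ultralimits of the families [phi s y] give a
  nonexpansive map from [Y] to the limit, and it is onto because preimages of
  the coordinates of a thread have an ultralimit in the compact space [Y].

The notion of upper bound mentions the spaces but not the arrows. So limits of
two surjective systems on the same spaces bound each other, and mutual bounds
between compact spaces are isometric ([le_ne_antisym]).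

For the equivalences, any of the three kinds of upper bound exhibits the
members as nonexpansive images of subsets of one compact space, whence uniform
compactness ([image_bounded_uniformly_compact]), the existence of the limit
[L], and the bound [le_ne (X s) L]. A common bound for all three orders is the
product of [L] with the space of bounded 1-Lipschitz functions on [L]: it maps
onto [L], and if [phi] maps [L] onto [X s] then the Kuratowski embedding
sending [x] to the function [mdist x (phi y)] of [y] puts [X s] inside it
isometrically ([universal_space_le_i]). *)

Set Implicit Arguments.
Unset Strict Implicit.
Unset Printing Implicit Defensive.

Import Order.TTheory GRing.Theory Num.Theory.
Import numFieldNormedType.Exports.

Local Open Scope classical_set_scope.
Local Open Scope ring_scope.

(** * Ultrafilters and limits in metric spaces *)

Lemma ultra_fmap T U (f : T -> U) (F : set_system T) :
  UltraFilter F -> UltraFilter (f @ F).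
Proof.
move=> FU; split=> [|G GF FG]; first exact: fmap_proper_filter.
rewrite eqEsubset; split=> [A GA|//].
have [//|FnA] := in_ultra_setVsetC (f @^-1` A) FU.
have GnA : G (~` A) by exact: FG.
by have [x []] := filter_ex (filterI GA GnA).
Qed.

(** An ultrafilter contains a set or its complement, so it contains a finite
union only if it contains one of the pieces. *)
Lemma ultra_pigeonhole T (F : set_system T) (N : nat) (P : nat -> set T) :
  UltraFilter F -> F [set t | exists2 i, (i < N)%N & P i t] ->
  exists2 i, (i < N)%N & F (P i).
Proof.
move=> FU; elim: N => [|N IH] FP.
  by have [t [i]] := filter_ex FP.
have [FN|FnN] := in_ultra_setVsetC (P N) FU; first by exists N.
have [|i iN Fi] := IH; last by exists i => //; exact: ltnW.
near=> t; have [i] : exists2 i, (i < N.+1)%N & P i t by near: t.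
rewrite ltnS leq_eqVlt => /predU1P[->|iN Pit]; last by exists i.
by have : (~` P N) t by near: t.
Unshelve. all: by end_near. Qed.

Section MetricLimits.
Context {R : realType}.

Lemma cvg_mdistP T (F : set_system T) (X : metricType R) (f : T -> X) (x : X) :
  Filter F ->
  f @ F --> x <-> forall e, 0 < e -> \forall t \near F, mdist (f t) x <= e.
Proof.
move=> FF; split=> [fx e e0|fx].
  have Fx : F [set t | ball x e (f t)] by exact: fx (nbhsx_ballx x e e0).
  apply: filterS Fx => t /=.
  by rewrite ballEmdist/= metric_sym => /ltW.
apply/cvg_ballP => e e0; have /fx : 0 < e / 2 by rewrite divr_gt0.
apply: filterS => t fe; rewrite ballEmdist/= metric_sym.
by rewrite (le_lt_trans fe)// ltr_pdivrMr// ltr_pMr// ltr1n.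
Qed.

Lemma cvg_mdist_le T (F : set_system T) (X : metricType R) (f g : T -> X)
    (x y : X) c :
  ProperFilter F -> f @ F --> x -> g @ F --> y ->
  (\forall t \near F, mdist (f t) (g t) <= c) -> mdist x y <= c.
Proof.
move=> FF /cvg_mdistP fx /cvg_mdistP gy fg; apply/ler_addgt0Pl => e e0.
have e2 : 0 < e / 2 by rewrite divr_gt0.
near F => t.
have h1 : mdist (f t) x <= e / 2 by near: t; exact: fx.
have h2 : mdist (g t) y <= e / 2 by near: t; exact: gy.
have h3 : mdist (f t) (g t) <= c by near: t.
have := metric_triangle x (f t) y; have := metric_triangle (f t) (g t) y.
rewrite (metric_sym x (f t)); lra.
Unshelve. all: by end_near. Qed.

Lemma cvg_near_eq T (F : set_system T) (X : metricType R) (f g : T -> X)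
    (x y : X) :
  ProperFilter F -> f @ F --> x -> g @ F --> y ->
  (\forall t \near F, f t = g t) -> x = y.
Proof.
move=> FF fx gy fg; apply: mdist_positivity; apply/eqP.
rewrite eq_le mdist_ge0 andbT; apply: (cvg_mdist_le FF fx gy).
by apply: filterS fg => t ->; rewrite mdistxx.
Qed.

Lemma nonexpansive_cvg T (F : set_system T) (X Y : metricType R) (h : X -> Y)
    (f : T -> X) (x : X) :
  Filter F -> nonexpansive h -> f @ F --> x -> h \o f @ F --> h x.
Proof.
move=> FF hn /cvg_mdistP fx; apply/cvg_mdistP => e /fx.
by apply: filterS => t; exact: le_trans (hn _ _).
Qed.

Lemma ultra_cvg (T : Type) (F : set_system T) (X : cmSpace R) (f : T -> X) :
  UltraFilter F -> exists x : X, f @ F --> x.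
Proof.
move=> FU; have := @cm_compact R X; rewrite compact_ultra => /(_ (f @ F)).
case; [exact: ultra_fmap|exact: filterT|by move=> x [_ ?]; exists x].
Qed.

(** Converse of [ultra_cvg]; the only way in which compactness of a space built
below is established. *)
Lemma ultra_compact (X : metricType R) :
  (forall F : set_system X, UltraFilter F ->
    exists x, forall e, 0 < e -> F [set y | mdist y x <= e]) ->
  compact [set: X].
Proof.
move=> ult; rewrite compact_ultra => F FU _.
have [x Fx] := ult F FU; exists x; split=> //=.
exact/(@cvg_mdistP _ F X id).
Qed.

End MetricLimits.

(** * Metrics defined as a supremum of pseudometrics *)

(** The spaces built below (threads, functions, the point) carry metrics of the
same shape, the supremum of a bounded separating family of pseudometrics. *)
Record gauge (R : realType) (T J : Type) := Gauge {
  gauge_fun :> J -> T -> T -> R;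
  gauge_xx : forall j x, gauge_fun j x x = 0;
  gauge_sym : forall j x y, gauge_fun j x y = gauge_fun j y x;
  gauge_triangle : forall j y x z,
    gauge_fun j x z <= gauge_fun j x y + gauge_fun j y z;
  gauge_bounded : exists D, forall j x y, gauge_fun j x y <= D;
  gauge_separated : forall x y, (forall j, gauge_fun j x y = 0) -> x = y
}.

(** A copy of [T] indexed by the gauge, so that the metric can be attached to
the type although it depends on [G]. *)
Definition gauge_space R T J (G : @gauge R T J) : Type := T.

Section GaugeSpace.
Context {R : realType} {T J : Type} (G : gauge R T J).

(** Adding 0 to the set makes the supremum meaningful when [J] is empty. *)
Definition gauge_dist (x y : T) : R := sup (0 |` range (fun j => G j x y)).

Lemma gauge_dist_leP x y c :
  gauge_dist x y <= c <-> 0 <= c /\ forall j, G j x y <= c.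
Proof.
have [D GD] := gauge_bounded G.
have ub : has_ubound (0 |` range (fun j => G j x y)).
  exists (Num.max 0 D) => _ [->|[j _ <-]]; rewrite le_max ?lexx//.
  by rewrite GD orbT.
split=> [dc|[c0 Gc]].
  split=> [|j]; apply: le_trans dc; apply: ub_le_sup => //; first by left.
  by right; exists j.
by apply: ge_sup => [|_ [->|[j _ <-]]] //; exists 0; left.
Qed.

Lemma gauge_le_dist x y j : G j x y <= gauge_dist x y.
Proof. by have /gauge_dist_leP[_] := lexx (gauge_dist x y); exact. Qed.

Let gauge_ge0 j x y : 0 <= G j x y.
Proof.
have := gauge_triangle G j y x x.
rewrite gauge_xx (gauge_sym _ j y) => h; lra.
Qed.

Let gauge_dist_ge0 x y : 0 <= gauge_dist x y.
Proof. by have /gauge_dist_leP[] := lexx (gauge_dist x y). Qed.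

Let gauge_distxx x : gauge_dist x x = 0.
Proof.
apply/eqP; rewrite eq_le gauge_dist_ge0 andbT; apply/gauge_dist_leP.
by split=> // j; rewrite gauge_xx.
Qed.

Let gauge_dist_positivity x y : gauge_dist x y = 0 -> x = y.
Proof.
move=> xy; apply: (gauge_separated (g := G)) => j; apply/eqP.
by rewrite eq_le gauge_ge0 andbT -xy gauge_le_dist.
Qed.

Let gauge_dist_sym x y : gauge_dist x y = gauge_dist y x.
Proof.
rewrite /gauge_dist; suff -> : (fun j => G j x y) = (fun j => G j y x) by [].
by apply/funext => j; rewrite gauge_sym.
Qed.

Let gauge_dist_triangle y x z :
  gauge_dist x z <= gauge_dist x y + gauge_dist y z.
Proof.
apply/gauge_dist_leP; split=> [|j]; first by rewrite addr_ge0.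
by rewrite (le_trans (gauge_triangle G j y x z))// lerD// gauge_le_dist.
Qed.

HB.instance Definition _ := gen_eqMixin (gauge_space G).
HB.instance Definition _ := gen_choiceMixin (gauge_space G).
HB.instance Definition _ := @isMetric.Build R (gauge_space G) gauge_dist
  gauge_distxx gauge_dist_positivity gauge_dist_sym gauge_dist_triangle.

Lemma gauge_mdist_leP (x y : gauge_space G) c :
  mdist x y <= c <-> 0 <= c /\ forall j, G j x y <= c.
Proof. exact: gauge_dist_leP. Qed.

Lemma gauge_le_mdist (x y : gauge_space G) j : G j x y <= mdist x y.
Proof. exact: gauge_le_dist. Qed.

End GaugeSpace.

Section OnePoint.
Context (R : realType).

Let point_gauge : gauge R unit unit.
Proof.
exists (fun _ _ _ => 0) => //.
- by exists 0.
- by move=> [] [].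
Defined.

Definition point_space : cmSpace R.
Proof.
exists (gauge_space point_gauge); apply: ultra_compact => F FU.
exists tt => e e0.
apply: filterS filterT => -[] _ /=.
by rewrite mdistxx ltW.
Defined.

End OnePoint.

(** * Compact metric spaces *)

Section CompactMetric.
Context {R : realType}.

Lemma surjectiveP (X Y : metricType R) (f : X -> Y) :
  surjective f <-> forall y, exists x, f x = y.
Proof.
split=> [fs y|fs]; last first.
  by rewrite /surjective -subTset => y _; have [x <-] := fs y; exists x.
by have : [set: Y] y by []; rewrite -fs => -[x _ <-]; exists x.
Qed.

Lemma isometric_onto (X Y : metricType R) (f : X -> Y) :
  (forall x y, mdist (f x) (f y) = mdist x y) -> surjective f -> isometric X Y.
Proof.
move=> fi /surjectiveP fs; exists f; split=> //.
have [g gK] := choice fs; exists g => // x.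
by apply: mdist_positivity; rewrite -fi gK mdistxx.
Qed.

Lemma isometric_embedding_le_i (X Y : metricType R) (f : X -> Y) :
  (forall x y, mdist (f x) (f y) = mdist x y) -> le_i X Y.
Proof.
move=> fi; exists (range f).
have fr x : range f (f x) by exists x.
pose h x : set_type (range f) := SigSub (mem_set (fr x)).
apply: (@isometric_onto _ _ h); first exact: fi.
apply/surjectiveP => -[y yr]; have /set_mem[x _ fxy] := yr.
by exists x; apply: val_inj.
Qed.

Lemma le_ne_le_s (X Y : metricType R) : le_ne X Y -> le_s X Y.
Proof.
move=> [f [fn /surjectiveP fs]]; exists setT; split; first exact: closedT.
exists (f \o val); split; first by move=> x y; exact: fn.
apply/surjectiveP => x; have [y <-] := fs x.
by exists (SigSub (mem_set (I : setT y))).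
Qed.

(** The inverse of the isometry goes from the subset onto the space. *)
Lemma le_i_image (X Y : metricType R) :
  le_i X Y -> exists A : set Y, le_ne X (set_type A).
Proof.
move=> [A [f [[g fK gK] fi]]]; exists A, g; split.
  by move=> x y; rewrite -fi !gK.
by apply/surjectiveP => x; exists (f x).
Qed.

Lemma nat_ultrafilter :
  exists U : set_system nat, UltraFilter U /\ forall n, U [set m | (n <= m)%N].
Proof.
have [U [UU sU]] := ultraFilterLemma eventually_filter.
by exists U; split=> // n; apply: sU; exists n.
Qed.

Lemma compact_mdist_bounded (X : cmSpace R) :
  exists D : R, forall x y : X, mdist x y <= D.
Proof.
have [x0|X0] := pselect (exists x0 : X, True); last first.
  by exists 0 => x; case: X0; exists x.
case: x0 => x0 _; suff [D Dx0] : exists D : R, forall x : X, mdist x0 x <= D.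
  exists (D + D) => x y; have := metric_triangle x x0 y.
  by rewrite (metric_sym x x0); have := Dx0 x; have := Dx0 y; lra.
apply: contrapT => unb.
have /choice[f ff] : forall n : nat, exists x : X, n%:R < mdist x0 x.
  move=> n; apply: contrapT => nx; apply: unb; exists n%:R => x.
  by rewrite leNgt; apply/negP => xn; apply: nx; exists x.
have [U [UU tails]] := nat_ultrafilter.
have [x /cvg_mdistP fx] := ultra_cvg f UU.
have [m mx] : exists m : nat, mdist x0 x + 1 <= m%:R.
  exists (Num.truncn (mdist x0 x + 1)).+1; apply/ltW/truncnS_gt.
near U => n.
have h1 : mdist (f n) x <= 1 by near: n; exact: fx.
have h2 : (m <= n)%N by near: n; exact: tails.
have := ff n; have := metric_triangle x0 x (f n).
rewrite (metric_sym x (f n)); move: h2; rewrite -(ler_nat R); lra.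
Unshelve. all: by end_near. Qed.

(** Without a finite net, the complements of the balls of radius [e] would have
the finite intersection property; an ultrafilter containing all of them could
not converge. *)
Lemma compact_net (X : cmSpace R) (e : R) : 0 < e ->
  exists (N : nat) (A : set X), (A #<= `I_N)%card /\ eps_dense e A.
Proof.
move=> e0; apply: contrapT => nonet.
pose C (a : X) := [set x : X | e <= mdist x a].
have finC : finI [set: X] C.
  move=> D _; apply: contrapT => D0; apply: nonet.
  have /finite_setP[N DN] : finite_set [set` D] by exact: finite_fset.
  exists N, [set` D]; split; first by rewrite (card_le_eql DN).
  move=> x; apply: contrapT => xD; apply: D0; exists x => a aD.
  by rewrite /C/= leNgt; apply/negP => xa; apply: xD; exists a.
have [U [UU CU]] := ultraFilterLemma (finI_filter finC).
have [x /cvg_mdistP Ux] := ultra_cvg id UU.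
have UC : U (C x) by apply: CU; exists (C x) => //; exact: finI_from1.
have e2 : 0 < e / 2 by rewrite divr_gt0.
have [y [xy yx]] := filter_ex (filterI UC (Ux _ e2)).
have := le_trans (xy : e <= mdist y x) yx; lra.
Qed.

(** Follow [x] and [y] along backward orbits of [h]. By compactness two terms,
of ranks [n] and [n + k.+1], are close in both orbits. Applying [h] [n.+1]
times brings them to [h x] and to the [k]-th preimage of [x] (same for [y]),
which are thus close, and going back up from the [k]-th preimages to [x] and
[y] does not increase distances. So [mdist x y] is at most
[mdist (h x) (h y)] up to an arbitrarily small error. *)
Lemma surjective_nonexpansive_isometry (X : cmSpace R) (h : X -> X) :
  nonexpansive h -> surjective h -> forall x y, mdist (h x) (h y) = mdist x y.
Proof.
move=> hn /surjectiveP/choice[s sK] x y; apply/eqP; rewrite eq_le hn/=.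
have hit n m z : iter n h (iter (n + m) s z) = iter m s z.
  by elim: n => //= n IH; rewrite -iterS iterSr/= sK.
have itn n u v : mdist (iter n h u) (iter n h v) <= mdist u v.
  by elim: n => //= n; exact: le_trans.
apply/ler_addgt0Pl => e e0.
have [U [UU tails]] := nat_ultrafilter.
have [a /cvg_mdistP xa] := ultra_cvg (fun n => iter n s x) UU.
have [b /cvg_mdistP yb] := ultra_cvg (fun n => iter n s y) UU.
have e4 : 0 < e / 4 by rewrite divr_gt0.
have G : U [set n | mdist (iter n s x) a <= e / 4 /\
                    mdist (iter n s y) b <= e / 4].
  exact: filterI (xa _ e4) (yb _ e4).
have [n [xn yn]] := filter_ex G.
have [m [[xm ym] nm]] := filter_ex (filterI G (tails n.+1)).
pose k := (m - n.+1)%N; have mE : m = (n + k.+1)%N.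
  by rewrite /k addnS -addSn subnKC.
(* [h z] and the k-th preimage of [z] are the images under the same iterate of
   [h] of two points that are close to each other. *)
have close z c :
    mdist (iter n s z) c <= e / 4 -> mdist (iter m s z) c <= e / 4 ->
    mdist (h z) (iter k s z) <= e / 2.
  move=> zn zm.
  have -> : h z = iter n.+1 h (iter n s z).
    by rewrite iterS; congr h; have := hit n 0%N z; rewrite addn0.
  have -> : iter k s z = iter n.+1 h (iter m s z) by rewrite mE -addSnnS hit.
  rewrite (le_trans (itn _ _ _))// (le_trans (metric_triangle _ c _))//.
  rewrite (metric_sym c); lra.
have cx := close _ _ xn xm; have cy := close _ _ yn ym.
have : mdist x y <= mdist (iter k s x) (iter k s y).
  have := itn k (iter (k + 0) s x) (iter (k + 0) s y).
  by rewrite !hit addn0.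
have := metric_triangle (iter k s x) (h x) (iter k s y).
have := metric_triangle (h x) (h y) (iter k s y).
rewrite (metric_sym (iter k s x) (h x)); lra.
Qed.

(** The composite of the two maps is an isometry, so neither of them can
strictly shrink a distance. *)
Lemma le_ne_antisym (X Y : cmSpace R) : le_ne X Y -> le_ne Y X -> isometric X Y.
Proof.
move=> [g [gn /surjectiveP gs]] [f [fn fs]].
apply: (isometric_onto (f := f)) => // x y.
have := @surjective_nonexpansive_isometry X (g \o f) _ _ x y => /= gfi.
apply/eqP; rewrite eq_le fn/= -[leLHS]gfi//.
- by move=> u v; rewrite (le_trans (gn _ _)).
- apply/surjectiveP => u; have [v <-] := gs u.
  by move/surjectiveP : fs => /(_ v)[w <-]; exists w.
Qed.

(** * Bounded families are uniformly compact *)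

(** Nets of the members are images of one net of [Y]. A point of that net need
not lie in the subset [A], hence the loss of a factor 2: it is replaced by a
point of [A] near it when there is one, and sent anywhere otherwise. *)
Lemma image_bounded_uniformly_compact (I : Type) (X : I -> cmSpace R)
    (Y : cmSpace R) :
  (forall s, exists A : set Y, le_ne (X s) (set_type A)) -> uniformly_compact X.
Proof.
move=> XY; split.
  have [D YD] := compact_mdist_bounded Y; exists D => s.
  have [A [f [fn /surjectiveP fs]]] := XY s.
  apply: ge_ereal_sup => _ [[x y] _ <-]; rewrite lee_fin/=.
  have [a <-] := fs x; have [b <-] := fs y.
  by rewrite (le_trans (fn _ _))//; exact: YD.
move=> e e0; have e2 : 0 < e / 2 by rewrite divr_gt0.
have [N [B [BN Bd]]] := @compact_net Y _ e2; exists N => s.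
have [A [f [fn /surjectiveP fs]]] := XY s.
have [[x0 _]|X0] := pselect (exists x0 : X s, True); last first.
  exists set0; split; first exact: card_ge0.
  by move=> x; case: X0; exists x.
have /choice[g gB] : forall y : Y, exists x : X s,
    forall a, mdist (val a) y < e / 2 -> mdist (f a) x < e.
  move=> y.
  have [[b by_]|nb] := pselect (exists b : set_type A, mdist (val b) y < e / 2).
    exists (f b) => a ay; rewrite (le_lt_trans (fn _ _))//.
    have : mdist (val a) (val b) < e.
      have := metric_triangle (val a) y (val b).
      by rewrite (metric_sym y); lra.
    exact.
  by exists x0 => a ay; case: nb; exists a.
exists (g @` B); split; first by rewrite (card_le_trans (card_image_le _ _)).
move=> x; have [a <-] := fs x; have [y By ay] := Bd (val a).
by exists (g y); [exists y|exact: gB].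
Qed.

End CompactMetric.

(** * Threads of an inverse system *)

Section Threads.
Context {R : realType} {disp : Order.disp_t} {I : preorderType disp}.
Context {X : I -> cmSpace R} (S : inverse_system X).
Implicit Types (x z w : forall s, X s).

Definition is_thread x := forall s t (st : (s <= t)%O), conn S st (x t) = x s.

Lemma cone_thread (A : cmSpace R) (p : forall s, A -> X s) a :
  is_cone S p -> is_thread (p^~ a).
Proof. by move=> [_ pc] s t st; rewrite -(pc s t st). Qed.

(** The image in [X s] of the entry of [z] at [t]. When [t] is not above
[s] there is no arrow, and [z s] is a filler that limits along the tails do not
see. *)
Definition pull z s t : X s :=
  if pselect ((s <= t)%O) is left st then conn S st (z t) else z s.

Lemma pullE z s t (st : (s <= t)%O) : pull z s t = conn S st (z t).
Proof.
by rewrite /pull; case: pselect => // st'; rewrite (Prop_irrelevance st' st).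
Qed.

Definition tail_ultrafilter (U : set_system I) :=
  UltraFilter U /\ forall s, U [set t | (s <= t)%O].

Lemma tail_ultrafilter_exists :
  upward_directed I -> I -> exists U, tail_ultrafilter U.
Proof.
move=> dir i0.
have /ultraFilterLemma[U [UU tU]] :
    ProperFilter (filter_from [set: I] (fun s => [set t | (s <= t)%O])).
  apply: filter_from_proper; last by move=> s _; exists s => /=.
  apply: filter_from_filter; first by exists i0.
  move=> s t _ _; have [u [su tu]] := dir s t; exists u => // v /= uv.
  by split; [exact: le_trans su uv|exact: le_trans tu uv].
by exists U; split=> // s; apply: tU; exists s.
Qed.

Section UltraThread.
Context (U : set_system I) (tU : tail_ultrafilter U).

Let UU : UltraFilter U := tU.1.
Local Existing Instance UU.

(** The thread to which the family [z] converges along [U], coordinatewise. *)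
Definition ultrathread z s : X s := projT1 (cid (ultra_cvg (pull z s) UU)).

Lemma ultrathread_cvg z s : pull z s @ U --> ultrathread z s.
Proof. by rewrite /ultrathread; case: cid. Qed.

(** Connecting maps commute with limits, and the images of [z r] in [X t] and
[X s] are already compatible once [r] is above [t]. *)
Lemma ultrathread_is_thread z : is_thread (ultrathread z).
Proof.
move=> s t st.
have h : conn S st \o pull z t @ U --> conn S st (ultrathread z t).
  exact: nonexpansive_cvg (conn_nonexpansive S st) (@ultrathread_cvg z t).
apply: (cvg_near_eq _ h (@ultrathread_cvg z s)).
have := tU.2 t; apply: filterS => r /= tr.
have sr := le_trans st tr.
by rewrite /= !pullE -(conn_comp S st tr sr).
Qed.

Lemma ultrathread_fix z s (a : X s) :
  (forall t (st : (s <= t)%O), conn S st (z t) = a) -> ultrathread z s = a.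
Proof.
move=> zx; apply: (cvg_near_eq _ (@ultrathread_cvg z s) (cvg_cst a)).
by have := tU.2 s; apply: filterS => t /= st; rewrite pullE zx.
Qed.

Lemma ultrathread_id x : is_thread x -> forall s, ultrathread x s = x s.
Proof. by move=> xT s; apply: ultrathread_fix => t st; exact: xT. Qed.

(** The arrows shrink distances, so a bound that holds between the entries of
two families for [U]-most indices passes to all coordinates. *)
Lemma ultrathread_mdist_le z w c :
  (\forall t \near U, mdist (z t) (w t) <= c) ->
  forall s, mdist (ultrathread z s) (ultrathread w s) <= c.
Proof.
move=> zw s.
apply: (cvg_mdist_le _ (@ultrathread_cvg z s) (@ultrathread_cvg w s)).
apply: filterS (filterI (tU.2 s) zw) => t [/= st].
by rewrite !pullE; apply: le_trans; exact: conn_nonexpansive.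
Qed.

End UltraThread.

(** Choose in each [X t] above [s] a preimage of [a]; the ultralimit of these
preimages has coordinate [a] at [s]. *)
Lemma thread_through : upward_directed I -> surjective_system S ->
  forall s (a : X s), exists2 x, is_thread x & x s = a.
Proof.
move=> dir Ssurj s a; have [U tU] := tail_ultrafilter_exists dir s.
(* For [t] not above [s] any point of [X t] will do, but there must be one: it
   comes from a lift of [a] to a common upper bound of [s] and [t]. *)
have Xs t : exists b : X t, forall st : (s <= t)%O, conn S st b = a.
  have [u [su tu]] := dir s t.
  have [c ca] := (surjectiveP _).1 (Ssurj s u su) a.
  by exists (conn S tu c) => st; rewrite -ca -(conn_comp S st tu su).
pose z t := projT1 (cid (Xs t)).
have za t (st : (s <= t)%O) : conn S st (z t) = a.
  by rewrite /z; case: cid.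
exists (ultrathread tU z); first exact: ultrathread_is_thread.
exact: ultrathread_fix.
Qed.


(** * Inverse limits of compact metric spaces *)

Section Limits.
Context (A : cmSpace R) (p : forall s, A -> X s).
Context (limAp : is_inverse_limit S p).

(** A thread is a cone over the system with a one-point vertex. *)
Lemma limit_thread x : is_thread x -> exists a, forall s, p s a = x s.
Proof.
move=> xT; have [|nu [[_ nux] _]] := limAp.2 (point_space R) (fun s _ => x s).
  split=> [s a b|s t st]; first by rewrite mdistxx mdist_ge0.
  by apply/funext => a /=; rewrite xT.
exists (nu tt) => s; exact: (congr1 (@^~ tt) (nux s)).
Qed.

(** Two points with the same projections are two factorizations of the same cone
with a one-point vertex. *)
Lemma limit_separated a b : (forall s, p s a = p s b) -> a = b.
Proof.
move=> ab; have [|nu [_ nuU]] := limAp.2 (point_space R) (fun s _ => p s a).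
  split=> [s u v|s t st]; first by rewrite mdistxx mdist_ge0.
  by apply/funext => u /=; rewrite (cone_thread a limAp.1).
have cst_ne (c : A) : nonexpansive (fun _ : point_space R => c).
  by move=> u v; rewrite mdistxx mdist_ge0.
have -> : a = nu tt by rewrite (nuU (fun=> a)).
by rewrite (nuU (fun=> b))//; split=> // s; apply/funext => u /=; rewrite ab.
Qed.

Lemma limit_proj_surjective : upward_directed I -> surjective_system S ->
  forall s, surjective (p s).
Proof.
move=> dir Ssurj s; apply/surjectiveP => a.
have [x xT <-] := thread_through dir Ssurj a.
by have [b bx] := limit_thread xT; exists b.
Qed.

(** The maps [phi s] are unrelated to the arrows; passing to ultralimits makes
them into a cone. For a thread with coordinates [p s a], choose preimages
[y s] of them: the limit [l] of [y] in [Y] is mapped to [a], since the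
families [phi s l] and [phi s (y s)] are close for most [s]. *)
Lemma limit_least (Y : cmSpace R) : upward_directed I -> I ->
  (forall s, le_ne (X s) Y) -> le_ne A Y.
Proof.
move=> dir i0 XY; have [U tU] := tail_ultrafilter_exists dir i0.
have UU : UltraFilter U := tU.1.
pose phi s := projT1 (cid (XY s)).
have phin s : nonexpansive (phi s) by rewrite /phi; case: cid => ? [].
have phis s : forall a, exists y, phi s y = a.
  by apply/surjectiveP; rewrite /phi; case: cid => ? [].
pose xi s y := ultrathread tU (phi^~ y) s.
have [|nu [[nun nuxi] _]] := limAp.2 Y xi.
  split=> [s y y'|s t st].
    by apply: ultrathread_mdist_le; apply: filterS filterT => t _; exact: phin.
  by apply/funext => y /=; exact: ultrathread_is_thread.
exists nu; split=> //; apply/surjectiveP => a.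
have /choice[y ya] : forall s, exists y, phi s y = p s a by [].
have [l /cvg_mdistP yl] := ultra_cvg y UU.
exists l; apply: limit_separated => s.
rewrite -[LHS]/((p s \o nu) l) nuxi.
rewrite -(ultrathread_id tU (cone_thread a limAp.1)).
apply: mdist_positivity; apply/eqP; rewrite eq_le mdist_ge0 andbT.
apply/ler_addgt0Pl => e e0; rewrite addr0; apply: ultrathread_mdist_le.
have := yl e e0; apply: filterS => t yle; rewrite -ya.
by rewrite (le_trans (phin _ _ _))// metric_sym.
Qed.

End Limits.

End Threads.

(** * The inverse limit of a uniformly compact system *)

Lemma card_le_enum (T : choiceType) (A : set T) (N : nat) : T ->
  (A #<= `I_N)%card -> exists f : nat -> T, forall a, A a ->
    exists2 i, (i < N)%N & f i = a.
Proof.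
move=> x0 AN; have fA : finite_set A by apply/finite_set_leP; exists N.
exists (nth x0 (fset_set A)) => a Aa.
have aA : a \in fset_set A by rewrite in_fset_set// mem_set.
exists (index a (fset_set A)); last by rewrite nth_index.
by rewrite (leq_trans _ (geq_card_fset_set AN))// index_mem.
Qed.

Section ThreadSpace.
Context {R : realType} {disp : Order.disp_t} {I : preorderType disp}.
Context {X : I -> cmSpace R} (S : inverse_system X).

Definition thread := {x : forall s, X s | is_thread S x}.

Definition thread_gauge (bX : uniformly_bounded X) : gauge R thread I.
Proof.
exists (fun s x y => mdist (sval x s) (sval y s)).
- by move=> s x; exact: mdistxx.
- by move=> s x y; exact: metric_sym.
- by move=> s y x z; exact: metric_triangle.
- have [D XD] := bX; exists D => s x y; rewrite -lee_fin.
  apply: le_trans (XD s); apply: ereal_sup_ubound.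
  by exists (sval x s, sval y s).
- move=> [x xT] [y yT] xy; apply: eq_exist.
  apply: functional_extensionality_dep => s.
  exact/mdist_positivity/xy.
Defined.

(** Coordinatewise an ultrafilter [F] of threads converges to a thread [l]; what
is at stake is that it does so uniformly in the coordinate. The nets of the
spaces [X s], numbered by the same [N] integers, have [N] ultralimits, and
each thread is within [e / 2] of one of them in all coordinates at once. By
the pigeonhole principle one of them serves for [F]-most threads, hence for
[l] too. *)
Lemma thread_space_compact (bX : uniformly_bounded X) : upward_directed I ->
  uniformly_compact X -> compact [set: gauge_space (thread_gauge bX)].
Proof.
move=> dir [_ netX]; apply: ultra_compact => F FU.
have [x0 _] : [set: thread] !=set0 by exact: (@filter_ex _ F _ _ filterT).
have limF s := ultra_cvg (fun x : thread => sval x s) FU.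
pose l s := projT1 (cid (limF s)).
have lF s : (fun x : thread => sval x s) @ F --> l s by rewrite /l; case: cid.
have lT : is_thread S l.
  move=> s t st.
  have h : conn S st \o (fun x : thread => sval x t) @ F --> conn S st (l t).
    exact: nonexpansive_cvg (conn_nonexpansive S st) (lF t).
  apply: (cvg_near_eq _ h (lF s)); apply: filterS filterT => x _.
  exact: (svalP x).
pose lt : thread := exist _ l lT; exists lt => e e0.
suff : F [set x : thread | forall s, mdist (sval x s) (l s) <= e].
  by apply: filterS => x xe; apply/gauge_mdist_leP; split; first exact: ltW.
have [[i0 _]|noI] := pselect (exists i0 : I, True); last first.
  by apply: filterS filterT => x _ s; case: noI; exists s.
have [U tU] := tail_ultrafilter_exists dir i0; have UU : UltraFilter U := tU.1.
have e2 : 0 < e / 2 by rewrite divr_gt0.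
have [N netN] := netX _ e2.
have enumX s : exists f : nat -> X s, forall b,
    exists2 i, (i < N)%N & mdist b (f i) <= e / 2.
  have [A [AN Ad]] := netN s; have [f fA] := card_le_enum (sval x0 s) AN.
  exists f => b; have [a /fA[i iN <-] ba] := Ad b.
  by exists i => //; exact: ltW.
pose c i s := projT1 (cid (enumX s)) i.
have cP s b : exists2 i, (i < N)%N & mdist b (c i s) <= e / 2.
  by rewrite /c; case: cid.
have [i _ Fi] : exists2 i, (i < N)%N & F [set x : thread |
    forall s, mdist (sval x s) (ultrathread S tU (c i) s) <= e / 2].
  (* Two pigeonholes: over the threads for [F], then for each thread [x] over
     the indices for [U]. *)
  apply: ultra_pigeonhole; apply: filterS filterT => x _ /=.
  have [|i iN Ui] := @ultra_pigeonhole _ U N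
    (fun i => [set t | mdist (sval x t) (c i t) <= e / 2]) UU.
    by apply: filterS filterT => t _; exact: cP.
  exists i => // s; rewrite -(ultrathread_id tU (svalP x) s).
  exact: ultrathread_mdist_le.
have lc s : mdist (l s) (ultrathread S tU (c i) s) <= e / 2.
  apply: (cvg_mdist_le _ (lF s) (cvg_cst _)).
  by apply: filterS Fi => x; exact.
apply: filterS Fi => x xc s; have := xc s; have := lc s.
have := metric_triangle (sval x s) (ultrathread S tU (c i) s) (l s).
rewrite (metric_sym (l s)); lra.
Qed.

Lemma uniformly_compact_has_limit : upward_directed I ->
  uniformly_compact X -> has_inverse_limit S.
Proof.
move=> dir UC; pose L := CMSpace (@thread_space_compact UC.1 dir UC).
exists L, (fun s x => sval x s); split.
  split=> [s x y|s t st]; first exact: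
    (gauge_le_mdist (x : gauge_space (thread_gauge UC.1)) y s).
  by apply/funext => x /=; exact: (svalP x).
move=> A xi xic; exists (fun a => exist _ _ (cone_thread a xic)); split.
  split=> // a b; apply/gauge_mdist_leP; split=> [|s]; first exact: mdist_ge0.
  exact: xic.1.
move=> nu [_ nuxi]; apply/funext => a; case E : (nu a) => [x xT].
apply: eq_exist; apply: functional_extensionality_dep => s.
by rewrite -nuxi /= E.
Qed.

End ThreadSpace.

(** * A universal compact space for the images of a compact space *)

Section Kuratowski.
Context {R : realType} (Y : cmSpace R) (D : R).

Definition bounded_lipschitz (f : Y -> R) :=
  (forall x y, `|f x - f y| <= mdist x y) /\ forall x, 0 <= f x <= D.

(** The first factor makes the space larger than [Y] for [le_ne]; the second one
contains the Kuratowski images of the nonexpansive images of [Y]. *)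
Definition point_and_function := (Y * {f : Y -> R | bounded_lipschitz f})%type.

Context (mdistD : forall x y : Y, mdist x y <= D).

Definition point_and_function_gauge : gauge R point_and_function (option Y).
Proof.
exists (fun j (u v : point_and_function) =>
  if j is Some z then `|sval u.2 z - sval v.2 z| else mdist u.1 v.1).
- by move=> [z|] u; [rewrite subrr normr0|exact: mdistxx].
- by move=> [z|] u v; [exact: distrC|exact: metric_sym].
- by move=> [z|] v u w; [exact: ler_distD|exact: metric_triangle].
- exists D => -[z|] [u [f [fl fb]]] [v [g [gl gb]]] /=; last exact: mdistD.
  by have /andP[] := fb z; have /andP[] := gb z; rewrite ler_norml; lra.
- move=> [x [f fl]] [y [g gl]] xy.
  have -> : x = y by exact/mdist_positivity/(xy None).
  suff fg : f = g by rewrite (eq_exist fl gl fg).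
  apply/funext => z; apply/eqP; rewrite -subr_eq0 -normr_eq0; apply/eqP.
  exact: (xy (Some z)).
Defined.

(** This contains the theorem of Arzela and Ascoli for 1-Lipschitz functions.
Let [g] be the pointwise limit. If uniform closeness to [g] failed for most [u],
it would fail at points [w u] having a limit [z]; but closeness at [z] extends
to nearby points by the Lipschitz condition. *)
Lemma point_and_function_compact :
  compact [set: gauge_space point_and_function_gauge].
Proof.
apply: ultra_compact => F FU.
have [x /cvg_mdistP Fx] := ultra_cvg (fun u : point_and_function => u.1) FU.
have /choice[g gP] : forall z, exists r, 0 <= r <= D /\
    forall e, 0 < e -> F [set u : point_and_function | `|sval u.2 z - r| <= e].
  move=> z; have := @segment_compact R 0 D; rewrite compact_ultra.
  pose ev (u : point_and_function) := sval u.2 z.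
  move=> /(_ (ev @ F) (ultra_fmap ev FU)); case.
    by apply: (@filterE _ F) => u; rewrite /= in_itv; exact: (svalP u.2).2 z.
  move=> r [r01 Fr]; exists r; split; first by move: r01; rewrite /= in_itv.
  move=> e e0; move/cvgrPdist_le : Fr => /(_ e e0).
  by apply: filterS => u; rewrite distrC.
have gl : bounded_lipschitz g.
  split=> [a b|a]; last exact: (gP a).1.
  apply/ler_addgt0Pl => e e0; have e2 : 0 < e / 2 by rewrite divr_gt0.
  have [u [ua ub]] := filter_ex (filterI ((gP a).2 _ e2) ((gP b).2 _ e2)).
  have := (svalP u.2).1 a b; move: ua ub; rewrite /= !ler_norml.
  by move=> /andP[? ?] /andP[? ?] /andP[? ?]; apply/andP; split; lra.
exists (x, exist _ g gl) => e e0.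
suff Fg : F [set u : point_and_function | forall z, `|sval u.2 z - g z| <= e].
  apply: filterS (filterI (Fx e e0) Fg) => u [ux ug].
  by apply/gauge_mdist_leP; split=> [|[z|]]; [exact: ltW|exact: ug|exact: ux].
have [//|Fbad] := in_ultra_setVsetC
  [set u : point_and_function | forall z, `|sval u.2 z - g z| <= e] FU.
(* [u.1] is the filler where [u] is uniformly close to [g]: unlike a fixed point
   of [Y], it is available without knowing that [Y] is inhabited. *)
have /choice[w wP] : forall u : point_and_function, exists z,
    ~ (forall z, `|sval u.2 z - g z| <= e) -> ~ `|sval u.2 z - g z| <= e.
  move=> u; have [?|/existsNP[z uz]] :=
    pselect (forall z, `|sval u.2 z - g z| <= e); first by exists u.1.
  by exists z.
have [z /cvg_mdistP wz] := ultra_cvg w FU.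
have e3 : 0 < e / 3 by rewrite divr_gt0.
have [u [[uz uw] ubad]] :=
  filter_ex (filterI (filterI ((gP z).2 _ e3) (wz _ e3)) Fbad).
case: (wP u ubad).
have := (svalP u.2).1 (w u) z; have := gl.1 (w u) z.
move: uz uw; rewrite /= !ler_norml.
by move=> /andP[? ?] ? /andP[? ?] /andP[? ?]; apply/andP; split; lra.
Qed.

Definition universal_space : cmSpace R := CMSpace point_and_function_compact.

Let const0 : forall y0 : Y, bounded_lipschitz (fun=> 0).
Proof.
move=> y0; split=> [x y|_]; first by rewrite subrr normr0 mdist_ge0.
by rewrite lexx (le_trans (mdist_ge0 y0 y0)).
Qed.

Lemma universal_space_le_ne (X : metricType R) :
  le_ne X Y -> le_ne X universal_space.
Proof.
move=> [phi [phin /surjectiveP phis]]; exists (fun u => phi u.1); split.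
  move=> u v; apply: le_trans (phin _ _) _.
  exact: (gauge_le_mdist (u : gauge_space point_and_function_gauge) v None).
apply/surjectiveP => a; have [y <-] := phis a.
by exists (y, exist _ _ (const0 y)).
Qed.

(** Kuratowski embedding: the functions [mdist a (phi y)] and [mdist b (phi y)]
of [y] differ by at most [mdist a b], and by exactly that much where
[phi y = b]. Being functions on [Y] and not on [X], they lie in a space that
does not depend on [X]. *)
Lemma universal_space_le_i (X : metricType R) :
  le_ne X Y -> le_i X universal_space.
Proof.
move=> [phi [phin /surjectiveP phis]].
have [[x0 _]|X0] := pselect (exists x0 : X, True); last first.
  have f (x : X) : universal_space by case: X0; exists x.
  by apply: (@isometric_embedding_le_i _ _ _ f) => x; case: X0; exists x.
have [y0 _] := phis x0.
have kl x : bounded_lipschitz (fun y => mdist x (phi y)).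
  split=> [a b|y].
    have := phin a b; have := metric_triangle x (phi a) (phi b).
    have := metric_triangle x (phi b) (phi a).
    by rewrite ler_norml (metric_sym (phi b)); lra.
  rewrite mdist_ge0; have [y' <-] := phis x.
  by rewrite (le_trans (phin _ _)).
pose k x : universal_space := (y0, exist _ _ (kl x)).
apply: (@isometric_embedding_le_i _ _ _ k) => a b.
apply/eqP; rewrite eq_le; apply/andP; split.
  apply/gauge_mdist_leP; split=> [|[z|]] /=; first exact: mdist_ge0.
    have := metric_triangle a b (phi z); have := metric_triangle b a (phi z).
    by rewrite ler_norml (metric_sym b a); lra.
  by rewrite mdistxx mdist_ge0.
have [y yb] := phis b.
apply: le_trans (gauge_le_mdist
  (k a : gauge_space point_and_function_gauge) (k b) (Some y)).
by rewrite /= yb mdistxx subr0 ger0_norm// mdist_ge0.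
Qed.

End Kuratowski.

(** * The equivalences and the independence of the arrows *)

Section Main.
Context {R : realType} {disp : Order.disp_t} {I : preorderType disp}.
Context {X : I -> cmSpace R}.
Context (dir : upward_directed I).

Lemma limit_upper_bound (S : inverse_system X) (A : cmSpace R)
    (p : forall s, A -> X s) :
  surjective_system S -> is_inverse_limit S p -> forall s, le_ne (X s) A.
Proof.
move=> Ssurj limA s; exists (p s); split; first exact: limA.1.1.
exact: limit_proj_surjective limA dir Ssurj s.
Qed.

(** The limit of the first system bounds the common family of spaces, and the
limit of the second one is its least upper bound. *)
Lemma limit_le_ne (S S' : inverse_system X) (A B : cmSpace R)
    (p : forall s, A -> X s) (q : forall s, B -> X s) :
  surjective_system S -> is_inverse_limit S p -> is_inverse_limit S' q ->
  le_ne B A.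
Proof.
move=> Ssurj limA limB; have [[i0 _]|noI] := pselect (exists i0 : I, True).
  exact: (limit_least limB dir i0 (limit_upper_bound Ssurj limA)).
(* Over an empty index set both limits are single points. *)
have Iv (s : I) : False by apply: noI; exists s.
have [a _] := limit_thread limA (x := fun s => False_rect _ (Iv s))
  (fun s => False_rect _ (Iv s)).
have [b _] := limit_thread limB (x := fun s => False_rect _ (Iv s))
  (fun s => False_rect _ (Iv s)).
exists (fun=> b); split=> [u v|]; first by rewrite mdistxx mdist_ge0.
apply/surjectiveP => b'; exists a; apply: (limit_separated limB) => s.
by case: (Iv s).
Qed.

Lemma common_upper_bound (Y : cmSpace R) : (forall s, le_ne (X s) Y) ->
  exists Z : cmSpace R, forall s, le_ne (X s) Z /\ le_s (X s) Z /\ le_i (X s) Z.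
Proof.
move=> XY; have [D YD] := compact_mdist_bounded Y.
exists (universal_space YD) => s; have h := universal_space_le_ne YD (XY s).
by split=> //; split; [exact: le_ne_le_s|exact: universal_space_le_i].
Qed.

End Main.

Theorem theorem2p9 (R : realType) (disp : Order.disp_t) (I : preorderType disp)
    (X : I -> cmSpace R) (S : inverse_system X) :
  upward_directed I -> surjective_system S ->
  [<-> has_inverse_limit S;
       upper_bounded le_ne X;
       upper_bounded le_s X;
       upper_bounded le_i X;
       exists Y : cmSpace R, forall s, le_ne (X s) Y /\ le_s (X s) Y /\ le_i (X s) Y;
       uniformly_compact X] /\
  (forall (A : cmSpace R) (p : forall s, A -> X s), is_inverse_limit S p ->
   forall S' : inverse_system X, surjective_system S' ->
     has_inverse_limit S' /\
     forall (B : cmSpace R) (q : forall s, B -> X s), is_inverse_limit S' q ->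
       isometric A B).
Proof.
move=> dir Ssurj.
have ne_compact : upper_bounded le_ne X -> uniformly_compact X.
  move=> [Y XY]; apply: (image_bounded_uniformly_compact (Y := Y)) => s.
  by have [K [_ XK]] := le_ne_le_s (XY s); exists K.
have limit_ne : has_inverse_limit S -> upper_bounded le_ne X.
  by move=> [A [p limA]]; exists A; exact: limit_upper_bound limA.
have compact_all : uniformly_compact X -> exists Y : cmSpace R,
    forall s, le_ne (X s) Y /\ le_s (X s) Y /\ le_i (X s) Y.
  move=> /(uniformly_compact_has_limit S dir)/limit_ne[Y].
  exact: common_upper_bound.
split; first tfae.
- exact: limit_ne.
- by move=> [Y XY]; exists Y => s; exact: le_ne_le_s.
- move=> [Y XY]; have [|Z XZ] := compact_all; last first.
    by exists Z => s; case: (XZ s) => _ [].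
  apply: (image_bounded_uniformly_compact (Y := Y)) => s.
  by have [K [_ XK]] := XY s; exists K.
- move=> [Y XY]; apply: compact_all.
  by apply: (image_bounded_uniformly_compact (Y := Y)) => s; exact: le_i_image.
- by move=> [Y XY]; apply: ne_compact; exists Y => s; exact: (XY s).1.
- exact: uniformly_compact_has_limit.
move=> A p limA S' S'surj; split=> [|B q limB].
  apply: uniformly_compact_has_limit => //; apply/ne_compact/limit_ne.
  by exists A, p.
apply: le_ne_antisym; first exact: limit_le_ne limB limA.
exact: limit_le_ne limA limB.
Qed.
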